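(* Let $X$ be a real Banach space with norm $\|\cdot\|$, and let $\Phi: X\to\mathbb{R}$ be a locally Lipschitz functional. For $z_0,z_1\in X$ define $$\Gamma:=\{c\in C^0([0,1];X): c(0)=z_0,\ c(1)=z_1\},\qquad \gamma:=\inf_{c\in\Gamma}\max_{0\le t\le 1}\Phi(c(t)),$$ and set $\Phi_\gamma:=\{x\in X:\Phi(x)\ge\gamma\}$. If $F\subset X$ is a closed subset such that $F\cap\Phi_\gamma$ separates $z_0$ and $z_1$, then there exists a sequence $\{x_n\}\subset X$ such that $$\mathrm{dist}_\delta(x_n,F)\to 0,\qquad \Phi(x_n)\to\gamma,\qquad (1+\|x_n\|)\min_{y^*\in\partial\Phi(x_n)}\|y^*\|\to 0 .$$
   Context: $C^0([0,1];X)$ is the space of continuous maps from $[0,1]$ to $X$. Clarke generalized gradient: for a locally Lipschitz $\Phi:X\to\mathbb{R}$, the generalized directional derivative is $\Phi^0(x,v):=\limsup_{w\to x,\ t\downarrow 0}\frac{\Phi(w+tv)-\Phi(w)}{t}$, and $\partial\Phi(x):=\{x^*\in X^*:\langle x^*,v\rangle\le\Phi^0(x,v)\ \forall v\in X\}$. Geodesic distance: $\delta(x_1,x_2):=\inf\{l(c): c\in C^1([0,1],X),\ c(0)=x_1,\ c(1)=x_2\}$ with $l(c):=\int_0^1\frac{\|\dot c(t)\|}{1+\|c(t)\|}\,dt$; and $\mathrm{dist}_\delta(x,F):=\inf\{\delta(x,y):y\in F\}$. Separation: a closed set $S\subset X$ separates $z_0$ and $z_1$ if $X\setminus S=\Omega_0\cup\Omega_1$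 with $\Omega_0,\Omega_1$ open, $\Omega_0\cap\Omega_1=\emptyset$, $z_0\in\Omega_0$ and $z_1\in\Omega_1$. *)

(* Defs.v *)
From HB Require Import structures.
From mathcomp Require Import all_boot all_order all_algebra.
From mathcomp Require Import all_classical all_reals all_analysis.

Set Implicit Arguments.
Unset Strict Implicit.
Unset Printing Implicit Defensive.

Import Order.TTheory GRing.Theory Num.Theory.
Import numFieldNormedType.Exports.

Local Open Scope classical_set_scope.
Local Open Scope ring_scope.

Definition is_max {R : realType} (A : set R) (m : R) : Prop :=
  A m /\ ubound A m.

Definition is_min {R : realType} (A : set R) (m : R) : Prop :=
  A m /\ lbound A m.

Section Clarke.
Context {R : realType} {X : normedModType R}.
Implicit Types (Phi : X -> R) (f : {linear X -> R^o}).

Definition locally_lipschitz Phi : Prop :=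
  forall x : X, lipschitz_on (Phi : X -> R^o) (nbhs (x, x)).

(* p = (w, t), with w --> x and t decreasing to 0; the limsup is taken in
   \bar R so that it needs no boundedness side condition. *)
Definition clarke_derivative Phi (x v : X) : \bar R :=
  limf_esup (fun p : X * R => ((Phi (p.1 + p.2 *: v) - Phi p.1) / p.2)%:E)
            (filter_prod (nbhs x) 0^'+).

Definition dual_norm f : R := sup [set `|f v| | v in [set v | `|v| <= 1]].

Definition clarke_gradient Phi (x : X) : set {linear X -> R^o} :=
  [set f | continuous f /\
           forall v, ((f v : R)%:E <= clarke_derivative Phi x v)%E].

End Clarke.

(* Paths [0, 1] -> X are functions R -> X of which only the values on [0, 1]
   matter. *)
Section Paths.
Context {R : realType} {X : normedModType R}.
Implicit Types (c : R -> X) (x y z : X) (F : set X).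

Definition continuous_paths z0 z1 : set (R -> X) :=
  [set c | [/\ {within `[0 : R, 1], continuous c}, c 0 = z0 & c 1 = z1]].

Definition minimax_level (Phi : X -> R) z0 z1 : R :=
  inf [set m | exists2 c, continuous_paths z0 z1 c &
                 is_max [set Phi (c t) | t in `[0 : R, 1]] m].

Definition diff_quotient c (t s : R) : X := (s - t)^-1 *: (c s - c t).

(* Derivative relative to [0, 1]: one-sided at the endpoints. *)
Definition path_derivative c (t : R) : X :=
  lim (diff_quotient c t @ within `[0 : R, 1] t^').

Definition C1_path c : Prop :=
  (forall t, t \in `[0 : R, 1] ->
     cvg (diff_quotient c t @ within `[0 : R, 1] t^')) /\
  {within `[0 : R, 1], continuous (path_derivative c)}.

Definition path_length c : R :=
  \int[lebesgue_measure]_(t in `[0 : R, 1])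
     (`|path_derivative c t| / (1 + `|c t|)).

Definition geodesic_dist x1 x2 : R :=
  inf [set path_length c | c in [set c | [/\ C1_path c, c 0 = x1 & c 1 = x2]]].

Definition geodesic_dist_set x F : R := inf [set geodesic_dist x y | y in F].

Definition separates (S : set X) z0 z1 : Prop :=
  closed S /\
  exists O0 O1 : set X, [/\ ~` S = O0 `|` O1, open O0, open O1,
                            O0 `&` O1 = set0 & O0 z0 /\ O1 z1].

End Paths.

(* Main.v *)
(* Let M = F `&` {Phi >= gamma}, let u(x) = dist(x, M) / (1 + |x|), and penalize
   Phi by psi = eps max(0, eps - u), which is largest on M. Every path from z0
   to z1 meets M, so the maximum of Phi + psi along it is at least
   gamma + eps^2, and a nearly optimal path c comes within eps^2 / 4 of this.
   Ekeland's principle, for the order attached to the asymmetric distance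
   ln (1 + |x - y| / (1 + |x|)) and restricted to the paths that agree with c
   where u(c(t)) >= eps, gives a path k near c that cannot be improved. If every
   maximum point of Phi + psi along k had a direction of fast uniform descent,
   pushing k along these directions, glued by bump functions on [0, 1], would
   improve it. Hence some maximum point x satisfies Phi^0(x, v) >= - r |v| for
   all v with r = 6 eps / (1 + |x|), and Hahn-Banach turns this into an element
   of the Clarke gradient of norm at most r. Straight segments suffice to bound
   the geodesic distance from x to F. *)
Require Import Defs.
From HB Require Import structures.
From mathcomp Require Import all_boot all_order all_algebra.
From mathcomp Require Import all_classical all_reals all_analysis.
From mathcomp Require Import lra ring.

Set Implicit Arguments.
Unset Strict Implicit.
Unset Printing Implicit Defensive.

Import Order.TTheory GRing.Theory Num.Theory.
Import numFieldNormedType.Exports.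
Local Open Scope classical_set_scope.
Local Open Scope ring_scope.

(** * Hahn-Banach theorem: a linear functional below a sublinear one *)

Definition sublinear {R : realType} {X : lmodType R} (q : X -> R) : Prop :=
  (forall u v, q (u + v) <= q u + q v) /\
  (forall t v, 0 <= t -> q (t *: v) <= t * q v).

Section HahnBanach.
Context {R : realType} {X : lmodType R}.
Implicit Types (p q : X -> R) (u v w : X).

Lemma sublinear0 q : sublinear q -> q 0 = 0.
Proof.
move=> [qD qZ]; have := qD 0 0; have := qZ 0 0 (lexx _).
rewrite scale0r addr0 mul0r; lra.
Qed.

Lemma sublinear_geN q v : sublinear q -> - q (- v) <= q v.
Proof.
move=> sq; have [qD _] := sq; have := qD v (- v).
rewrite subrr sublinear0//; lra.
Qed.

(** Nearly optimal members of the chain for [u] and for [v] are comparable, so the smaller one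
    serves both. The minorant [b] keeps the infimum finite. *)
Lemma inf_chain_sublinear (C : set (X -> R)) (b : X -> R) :
  C !=set0 -> (forall q, C q -> sublinear q) ->
  (forall q v, C q -> b v <= q v) ->
  (forall q1 q2, C q1 -> C q2 ->
     (forall v, q1 v <= q2 v) \/ (forall v, q2 v <= q1 v)) ->
  sublinear (fun v => inf [set q v | q in C]).
Proof.
move=> [q0 Cq0] Csub Cb Ctot.
have inf_C v : has_inf [set q v | q in C].
  split; first by exists (q0 v), q0.
  by exists (b v) => _ [q Cq <-]; exact: Cb.
have inf_lb q v : C q -> inf [set q v | q in C] <= q v.
  by move=> Cq; apply: ge_inf; [exact: (inf_C v).2|exists q].
split=> [u v|t v t0].
- apply/ler_addgt0Pl => e e0.
  have e20 : 0 < e / 2 by rewrite divr_gt0.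
  have [_ [q1 Cq1 <-] q1u] := inf_adherent e20 (inf_C u).
  have [_ [q2 Cq2 <-] q2v] := inf_adherent e20 (inf_C v).
  case: (Ctot _ _ Cq1 Cq2) => [q12|q21].
  + have := inf_lb _ (u + v) Cq1; have := (Csub _ Cq1).1 u v.
    have := q12 v; lra.
  + have := inf_lb _ (u + v) Cq2; have := (Csub _ Cq2).1 u v.
    have := q21 u; lra.
- apply/ler_addgt0Pl => e e0.
  (* Dividing by [t + 1] instead of [t] covers [t = 0] as well. *)
  have t1 : 0 < t + 1 by lra.
  have [_ [q Cq <-] qv] := inf_adherent (divr_gt0 e0 t1) (inf_C v).
  have := inf_lb _ (t *: v) Cq; have := (Csub _ Cq).2 t v t0.
  have /(ler_wpM2l t0) := ltW qv.
  have : t * (e / (t + 1)) <= e.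
    by rewrite mulrA ler_pdivrMr//; have := mulr_ge0 t0 (ltW e0); nra.
  rewrite mulrDr; lra.
Qed.

(** Zorn's lemma for the reversed pointwise order on the sublinear functions below [p]. Each of them
    lies above [- p (- v)], so a nonempty chain has its pointwise infimum as a bound. *)
Lemma exists_minimal_sublinear p : sublinear p ->
  exists q, [/\ sublinear q, forall v, q v <= p v &
    forall q', sublinear q' -> (forall v, q' v <= q v) -> q' = q].
Proof.
move=> sp; pose P q := sublinear q /\ forall v, q v <= p v; pose T := {q | P q}.
pose below (s t : T) : bool := `[< forall v, sval t v <= sval s v >].
have [||||[q [sq qp]] qmin] := @Zorn T below.
- by move=> t; apply/asboolP => v.
- move=> r s t /asboolP rs /asboolP st; apply/asboolP => v.
  exact: le_trans (st v) (rs v).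
- move=> [s hs] [t ht] /asboolP /= st /asboolP /= ts.
  have Est : s = t by apply/funext => v; apply/le_anti; rewrite st ts.
  by case: _ / Est in ht {st ts} *; congr exist; exact: Prop_irrelevance.
- move=> A Atot; have [->|/set0P[a Aa]] := eqVneq A set0.
    by exists (exist P p (conj sp (fun=> lexx _))).
  pose C := [set sval t | t in A].
  have Cb q v : C q -> - p (- v) <= q v.
    move=> [t At <-]; have [st tp] := svalP t.
    by apply: le_trans (sublinear_geN _ st); rewrite lerN2.
  have sC : sublinear (fun v => inf [set q v | q in C]).
    apply: (@inf_chain_sublinear C (fun v => - p (- v))) => //.
    - by exists (sval a), a.
    - by move=> _ [t At <-]; exact: (svalP t).1.
    - move=> _ _ [s As <-] [t At <-].
      by have [/asboolP|/asboolP] := Atot _ _ As At; [right|left].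
  have Cinf t v : A t -> inf [set q v | q in C] <= sval t v.
    move=> At; apply: ge_inf; last by exists (sval t) => //; exists t.
    by exists (- p (- v)) => _ [q Cq <-]; exact: Cb.
  have Cp v : inf [set q v | q in C] <= p v.
    exact: le_trans (Cinf _ _ Aa) ((svalP a).2 v).
  exists (exist P 
    (fun v => inf [set q v | q in C]) (conj sC Cp)).
  by move=> s As; apply/asboolP => v; exact: Cinf.
exists q; split=> // q' sq' q'q.
have q'p v : q' v <= p v by exact: le_trans (q'q v) (qp v).
by have /(congr1 sval) := qmin (exist P q' (conj sq' q'p)) (asboolT q'q).
Qed.

(* If q is minimal, it equals v |-> inf_(t >= 0) q (v + t w) - t q w; taking
   v = - w and t = 1 gives q (- w) <= - q w. *)
Lemma minimal_sublinear_odd q w : sublinear q ->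
  (forall q', sublinear q' -> (forall v, q' v <= q v) -> q' = q) ->
  q (- w) = - q w.
Proof.
move=> sq qmin; have [qD qZ] := sq.
pose B v := [set q (v + t *: w) - t * q w | t in [set t : R | 0 <= t]].
have lbB v t : 0 <= t -> - q (- v) <= q (v + t *: w) - t * q w.
  move=> t0; have := qD (v + t *: w) (- v); have := qZ t w t0.
  have -> : v + t *: w - v = t *: w by rewrite addrC addKr.
  have := sublinear_geN (t *: w) sq.
  (* [sublinear] states homogeneity as [<=] only; scaling back by [t^-1] gives the other
     inequality. *)
  have : t * q w <= q (t *: w).
    have [->|tn0] := eqVneq t 0; first by rewrite scale0r mul0r sublinear0.
    have tp : 0 < t by rewrite lt_def tn0.
    have := qZ t^-1 (t *: w); rewrite invr_ge0 t0 scalerA mulVf// scale1r.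
    by move=> /(_ isT); rewrite -ler_pdivlMl// .
  lra.
have infB v : has_inf (B v).
  split; first by exists (q (v + 0 *: w) - 0 * q w), 0; rewrite /=.
  by exists (- q (- v)) => _ [t t0 <-]; exact: lbB.
have Ble v t : 0 <= t -> inf (B v) <= q (v + t *: w) - t * q w.
  by move=> t0; apply: ge_inf; [exact: (infB v).2|exists t].
have sB : sublinear (fun v => inf (B v)).
  split=> [u v|s v s0].
  - apply/ler_addgt0Pl => e e0.
    have e20 : 0 < e / 2 by rewrite divr_gt0.
    have [_ [t1 /= t10 <-] h1] := inf_adherent e20 (infB u).
    have [_ [t2 /= t20 <-] h2] := inf_adherent e20 (infB v).
    have := Ble (u + v) (t1 + t2) (addr_ge0 t10 t20).
    have := qD (u + t1 *: w) (v + t2 *: w).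
    rewrite scalerDl addrACA mulrDl; lra.
  - apply/ler_addgt0Pl => e e0.
    have s1 : 0 < s + 1 by lra.
    have [_ [t /= t0 <-] h] := inf_adherent (divr_gt0 e0 s1) (infB v).
    have := Ble (s *: v) (s * t) (mulr_ge0 s0 t0).
    have := qZ s (v + t *: w) s0.
    rewrite -scalerA -scalerDr -mulrA.
    have /(ler_wpM2l s0) := ltW h.
    have : s * (e / (s + 1)) <= e.
      by rewrite mulrA ler_pdivrMr//; have := mulr_ge0 s0 (ltW e0); nra.
    rewrite !mulrDr mulrN; lra.
have Bq v : inf (B v) <= q v.
  by have := Ble v 0 (lexx _); rewrite scale0r addr0 mul0r subr0.
have /(congr1 (fun f => f (- w))) := qmin _ sB Bq.
have := Ble (- w) 1 ler01; rewrite scale1r addNr sublinear0// mul1r sub0r.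
move=> h1 h2; have := sublinear_geN (- w) sq; rewrite opprK => h3.
move: h1; rewrite h2 => h1; lra.
Qed.

(** A minimal sublinear function below [p] is odd, and oddness turns subadditivity and positive
    homogeneity into equalities. *)
Theorem hahn_banach p : sublinear p ->
  exists f : {linear X -> R^o}, forall v, (f v : R) <= p v.
Proof.
move=> /exists_minimal_sublinear[q [sq qp qmin]].
have qN w : q (- w) = - q w by exact: minimal_sublinear_odd.
have [qD qZ] := sq.
have qDE u v : q (u + v) = q u + q v.
  apply/le_anti; rewrite qD/=.
  by have := qD (- u) (- v); rewrite -opprD !qN; lra.
have qZ0 t v : 0 <= t -> q (t *: v) = t * q v.
  move=> t0; apply/le_anti; rewrite qZ//=.
  have := qZ t (- v) t0; rewrite scalerN !qN mulrN; lra.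
have linq : linear (q : X -> R^o).
  move=> t u v; rewrite qDE; congr (_ + _).
  have [/qZ0//|t0] := leP 0 t.
  rewrite -[t]opprK scaleNr qN qZ0 ?oppr_ge0 1?ltW//.
  by rewrite [RHS]/GRing.scale/=; ring.
pose f : {linear X -> R^o} :=
  HB.pack (q : X -> R^o) (GRing.isLinear.Build R X R^o _ (q : X -> R^o) linq).
by exists f.
Qed.

End HahnBanach.

(** * Clarke derivative, slope bounds and the minimal norm of the gradient *)

Section ClarkeBounds.
Context {R : realType} {X : normedModType R}.
Implicit Types (Phi : X -> R) (x y v w : X) (a r t : R).

(** A real-valued substitute for Phi^0(x, v) <= a: it follows from Phi^0(x, v) < a and implies
    Phi^0(x, v) <= a. *)
Definition dir_bound Phi x v a : Prop :=
  exists2 rho, 0 < rho & forall y t,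
    `|y - x| < rho -> 0 < t -> t < rho -> Phi (y + t *: v) - Phi y <= a * t.

Lemma clarke_lt_dir_bound Phi x v a :
  (clarke_derivative Phi x v < a%:E)%E -> dir_bound Phi x v a.
Proof.
move=> /ereal_inf_lt[_ [V [[A B] /= [Ax B0] ABV] <-] supV].
have [r1 /= r10 r1A] := (nbhs_ballP _ _).1 Ax.
have [r2 /= r20 r2B] := (nbhs_ballP _ _).1 B0.
exists (Num.min r1 r2); first by rewrite lt_min r10.
move=> y t; rewrite !lt_min => /andP[yr1 _] t0 /andP[_ tr2].
rewrite -ler_pdivrMr// -lee_fin; apply: le_trans (ltW supV).
apply: ereal_sup_ubound; exists (y, t) => //; apply: ABV; split=> /=.
  by apply: r1A; rewrite -ball_normE/= distrC.
by apply: r2B => //; rewrite -ball_normE/= sub0r normrN gtr0_norm.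
Qed.

Lemma dir_bound_clarke_le Phi x v a :
  dir_bound Phi x v a -> (clarke_derivative Phi x v <= a%:E)%E.
Proof.
move=> [rho rho0 h].
pose V := [set p : X * R | `|p.1 - x| < rho /\ (0 < p.2 /\ p.2 < rho)].
apply: ereal_inf_le; exists (ereal_sup
    ((fun p => ((Phi (p.1 + p.2 *: v) - Phi p.1) / p.2)%:E) @` V)).
  exists V => //; exists (ball x rho, [set t | 0 < t /\ t < rho]) => /=.
    split; first exact: nbhsx_ballx.
    apply/nbhs_ballP; exists rho => //= t; rewrite -ball_normE/= sub0r normrN.
    by move=> tr t0; split=> //; rewrite gtr0_norm in tr.
  by move=> [y t] /= [+ t0]; rewrite -ball_normE/= distrC; split.
apply: ge_ereal_sup => _ [[y t] /= [yx [t0 tr]] <-].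
by rewrite lee_fin ler_pdivrMr// h.
Qed.

Lemma locally_lipschitzP Phi x : locally_lipschitz Phi ->
  exists L rho, [/\ 0 < L, 0 < rho & forall y z,
    `|y - x| < rho -> `|z - x| < rho -> `|Phi y - Phi z| <= L * `|y - z|].
Proof.
move=> /(_ x)/pinfty_ex_gt0[L L0 /nbhs_ballP[rho /= rho0 h]].
exists L, rho; split=> // y z yx zx.
by apply: (h (y, z)); split; rewrite -ball_normE/= distrC.
Qed.

Lemma locally_lipschitz_continuous Phi :
  locally_lipschitz Phi -> continuous (Phi : X -> R^o).
Proof.
move=> lip x; have [L [rho [L0 rho0 h]]] := locally_lipschitzP x lip.
apply/cvgrPdist_le => e e0; near=> y.
apply: le_trans (h x y _ _) _; first by rewrite subrr normr0.
  near: y; apply/nbhs_ballP; exists rho => //= y.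
  by rewrite -ball_normE/= distrC.
rewrite mulrC -ler_pdivlMr//; apply: ltW.
near: y; apply/nbhs_ballP; exists (e / L); first by rewrite /= divr_gt0.
by move=> y; rewrite -ball_normE/=.
Unshelve. all: by end_near. Qed.

Lemma dir_bound_lip Phi x : locally_lipschitz Phi ->
  exists2 L, 0 < L & forall v, dir_bound Phi x v (L * `|v|).
Proof.
move=> lip; have [L [rho [L0 rho0 h]]] := locally_lipschitzP x lip.
exists L => // v; have v1 : 0 < 2 * (1 + `|v|) by have := normr_ge0 v; lra.
have v1' : 1 <= 2 * (1 + `|v|) by have := normr_ge0 v; lra.
(* Half of the radius is left for the displacement [t *: v], so both points stay in the ball where
   Phi is Lipschitz. *)
exists (Num.min (rho / 2) (rho / (2 * (1 + `|v|)))).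
  by rewrite lt_min !divr_gt0.
move=> y t; rewrite !lt_min => /andP[yx _] t0 /andP[_].
rewrite ltr_pdivlMr// => tr; apply: le_trans (ler_norm _) _.
have ntv : `|t *: v| = t * `|v| by rewrite normrZ gtr0_norm.
apply: le_trans (h _ _ _ _) _; last by rewrite addrC addKr ntv mulrAC mulrA.
  rewrite addrAC; apply: le_lt_trans (ler_normD _ _) _.
  rewrite ntv; have := mulr_ge0 (ltW t0) (normr_ge0 v); lra.
by lra.
Qed.

Lemma dir_bound0 Phi x : dir_bound Phi x 0 0.
Proof. by exists 1 => // y t _ _ _; rewrite scaler0 addr0 subrr mul0r. Qed.

Lemma dir_bound0_ge0 Phi x a : dir_bound Phi x 0 a -> 0 <= a.
Proof.
move=> [rho rho0 /(_ x (rho / 2))].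
rewrite subrr normr0 scaler0 addr0 subrr divr_gt0// ltr_pdivrMr//.
rewrite pmulr_lge0 ?divr_gt0//; apply=> //; lra.
Qed.

Lemma dir_boundZ Phi x v a s : 0 < s ->
  dir_bound Phi x v a -> dir_bound Phi x (s *: v) (s * a).
Proof.
move=> s0 [rho rho0 h]; exists (Num.min rho (rho / s)).
  by rewrite lt_min rho0 divr_gt0.
move=> y t; rewrite !lt_min => /andP[yx _] t0 /andP[_ ts].
rewrite scalerA; have := h y (t * s) yx; rewrite (mulrC s) -mulrA (mulrC s).
by apply; rewrite ?mulr_gt0// -ltr_pdivlMr.
Qed.

(** The increment is split at [y + t *: v]. This point is again close to [x], and the bound for [w]
    is uniform in the base point, so it applies there. *)
Lemma dir_boundD Phi x v w a b : dir_bound Phi x v a ->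
  dir_bound Phi x w b -> dir_bound Phi x (v + w) (a + b).
Proof.
move=> [r1 r10 h1] [r2 r20 h2].
have v1 : 0 < 2 * (1 + `|v|) by have := normr_ge0 v; lra.
exists (Num.min (Num.min r1 (r2 / 2)) (r2 / (2 * (1 + `|v|)))).
  by rewrite !lt_min r10 !divr_gt0.
move=> y t; rewrite !lt_min => /andP[/andP[y1 y2] _] t0 /andP[/andP[t1 t2]].
rewrite ltr_pdivlMr// => t3.
rewrite scalerDr addrA; have := h1 y t y1 t0 t1.
have : Phi (y + t *: v + t *: w) - Phi (y + t *: v) <= b * t.
  apply: h2 => //; last by lra.
  rewrite addrAC; apply: le_lt_trans (ler_normD _ _) _.
  rewrite normrZ gtr0_norm//.
  have := mulr_ge0 (ltW t0) (normr_ge0 v); lra.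
rewrite mulrDl; lra.
Qed.

(** Says that Phi^0(x, v) >= - r |v| for all v: no direction descends faster than r per unit
    length. *)
Definition slope_bound Phi x r : Prop :=
  0 <= r /\ forall v a, dir_bound Phi x v a -> - (r * `|v|) <= a.

Lemma linear_le_continuous (f : {linear X -> R^o}) r :
  (forall v, (f v : R) <= r * `|v|) ->
  (forall v, `|f v| <= r * `|v|) /\ continuous f.
Proof.
move=> fr; have fr' v : `|f v| <= r * `|v|.
  rewrite ler_norml fr andbT; have := fr (- v); rewrite linearN normrN.
  by rewrite lerNl.
split=> //; apply: bounded_linear_continuous; apply/linear_boundedP.
exists r; split=> [|s rs v]; first exact: num_real.
by apply: le_trans (fr' v) _; rewrite ler_wpM2r// ltW.
Qed.

Lemma has_sup_dual_norm (f : {linear X -> R^o}) : continuous f ->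
  has_sup [set `|f v| | v in [set v | `|v| <= 1]].
Proof.
move=> cf; split; first by exists `|f 0|, 0; rewrite //= normr0.
have /linear_boundedP/pinfty_ex_gt0[M M0 h] :=
  (linear_bounded_continuous f).2 cf.
exists M => _ [v /= v1 <-]; apply: le_trans (h v) _.
by rewrite -[leRHS]mulr1 ler_wpM2l// ltW.
Qed.

Lemma dual_norm_le (f : {linear X -> R^o}) r : 0 <= r ->
  (forall v, `|f v| <= r * `|v|) -> dual_norm f <= r.
Proof.
move=> r0 fr; apply: ge_sup; first by exists `|f 0|, 0; rewrite //= normr0.
move=> _ [v /= v1 <-]; apply: le_trans (fr v) _.
by rewrite -[leRHS]mulr1 ler_wpM2l.
Qed.

Lemma dual_norm_ge0 (f : {linear X -> R^o}) : continuous f -> 0 <= dual_norm f.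
Proof.
move=> cf; apply: le_trans (normr_ge0 (f 0)) _.
apply: ub_le_sup; first exact: (has_sup_dual_norm cf).2.
by exists 0; rewrite //= normr0.
Qed.

Lemma le_dual_norm (f : {linear X -> R^o}) v : continuous f ->
  `|f v| <= dual_norm f * `|v|.
Proof.
move=> cf; have [->|v0] := eqVneq v 0; first by rewrite linear0 !normr0 mulr0.
have nv : 0 < `|v| by rewrite normr_gt0.
rewrite -ler_pdivrMr//; apply: ub_le_sup.
  exact: (has_sup_dual_norm cf).2.
exists (`|v|^-1 *: v) => /=.
  by rewrite normrZ gtr0_norm ?invr_gt0// mulVf// gt_eqF.
by rewrite linearZ normrZ gtr0_norm ?invr_gt0// mulrC.
Qed.

Lemma clarke_gradient_slope_bound Phi x f :
  clarke_gradient Phi x f -> slope_bound Phi x (dual_norm f).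
Proof.
move=> [cf fPhi]; split=> [|v a ha]; first exact: dual_norm_ge0.
have : (f v : R) <= a.
  by rewrite -lee_fin; apply: le_trans (fPhi v) (dir_bound_clarke_le ha).
apply: le_trans; rewrite lerNl; apply: le_trans (le_dual_norm v cf).
by rewrite -normrN; exact: ler_norm.
Qed.

(* Hahn-Banach below the inf-convolution of the Clarke derivative with r |.|. *)
Lemma slope_bound_clarke_gradient Phi x r : locally_lipschitz Phi ->
  slope_bound Phi x r ->
  exists2 f, clarke_gradient Phi x f & dual_norm f <= r.
Proof.
move=> lip [r0 hr].
pose B v := [set p.2 + r * `|v - p.1| | p in
  [set p : X * R | dir_bound Phi x p.1 p.2]].
have lbB v : lbound (B v) (- (r * `|v|)).
  move=> _ [[w a] /= wa <-]; have := hr _ _ wa.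
  have : r * `|w| <= r * (`|v - w| + `|v|).
    by apply: ler_wpM2l => //; rewrite distrC -{1}[w](subrK v) ler_normD.
  rewrite mulrDr; lra.
have infB v : has_inf (B v).
  split; last by exists (- (r * `|v|)).
  by exists (0 + r * `|v - 0|), (0, 0); [exact: dir_bound0|].
have Ble v w a : dir_bound Phi x w a -> inf (B v) <= a + r * `|v - w|.
  by move=> wa; apply: ge_inf; [exact: (infB v).2|exists (w, a)].
have sB : sublinear (fun v => inf (B v)).
  split=> [u v|s v s0].
  - apply/ler_addgt0Pl => e e0.
    have e20 : 0 < e / 2 by rewrite divr_gt0.
    have [_ [[w1 a1] /= wa1 <-] h1] := inf_adherent e20 (infB u).
    have [_ [[w2 a2] /= wa2 <-] h2] := inf_adherent e20 (infB v).
    have := Ble (u + v) _ _ (dir_boundD wa1 wa2).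
    have : r * `|u + v - (w1 + w2)| <= r * (`|u - w1| + `|v - w2|).
      by apply: ler_wpM2l => //; rewrite opprD addrACA ler_normD.
    rewrite mulrDr; lra.
  - have [->|sn0] := eqVneq s 0.
      rewrite scale0r mul0r; have := Ble 0 _ _ (dir_bound0 Phi x).
      by rewrite subrr normr0 mulr0 addr0.
    have sp : 0 < s by rewrite lt_def sn0.
    apply/ler_addgt0Pl => e e0.
    have [_ [[w a] /= wa <-] h] := inf_adherent (divr_gt0 e0 sp) (infB v).
    have := Ble (s *: v) _ _ (dir_boundZ sp wa).
    rewrite -scalerBr normrZ gtr0_norm// mulrCA -mulrDr.
    move: h; rewrite -(ltr_pM2l sp) !mulrDr [s * (e / s)]mulrC divfK//; lra.
have [f fB] := hahn_banach sB.
have [fr cf] : (forall v, `|f v| <= r * `|v|) /\ continuous f.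
  apply: linear_le_continuous => v; apply: le_trans (fB v) _.
  by have := Ble v _ _ (dir_bound0 Phi x); rewrite subr0 add0r.
exists f; last exact: dual_norm_le.
(* If Phi^0(x, v) were below f v - e, the choice [w = v] would give inf (B v) <= f v - e, against f
   <= inf B. *)
split=> // v; apply/lee_addgt0Pr => e e0; rewrite leNgt; apply/negP => hlt.
have : (clarke_derivative Phi x v < (f v - e : R)%:E)%E.
  by rewrite EFinB lteBrDr.
move=> /clarke_lt_dir_bound/(Ble v); rewrite subrr normr0 mulr0 addr0 => h.
have := fB v; lra.
Qed.

(** Dual norms of gradient elements are slope bounds, and every slope bound dominates such a norm.
    Hence the minimal norm is the least slope bound, which exists because the defining inequalities
    are closed in r; this replaces weak-star compactness. *)
Lemma exists_min_clarke_gradient Phi x : locally_lipschitz Phi ->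
  exists m, [/\ is_min [set dual_norm f | f in clarke_gradient Phi x] m,
    0 <= m & forall r, slope_bound Phi x r -> m <= r].
Proof.
move=> lip; pose S := [set r | slope_bound Phi x r].
have lbS : lbound S 0 by move=> r [].
have infS : has_inf S.
  split; last by exists 0.
  (* Adding the bounds for [v] and [- v] gives 0 <= a + L |v|, so a local Lipschitz constant is a
     slope bound. *)
  have [L L0 hL] := dir_bound_lip x lip; exists L; split=> [|v a va].
    exact: ltW.
  have := dir_bound0_ge0; have := dir_boundD va (hL (- v)).
  by rewrite subrr => /dir_bound0_ge0; rewrite normrN; lra.
have infle r : slope_bound Phi x r -> inf S <= r.
  by move=> Sr; apply: ge_inf => //; exact: infS.2.
have inf0 : 0 <= inf S by apply: lb_le_inf => //; exact: infS.1.
have Sinf : slope_bound Phi x (inf S).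
  split=> // v a va; apply/ler_addgt0Pl => e e0.
  have v1 : 0 < 1 + `|v| by have := normr_ge0 v; lra.
  have [s [s0 hs] sS] := inf_adherent (divr_gt0 e0 v1) infS.
  have := hs _ _ va; have /(ler_wpM2r (normr_ge0 v)) := ltW sS.
  have : e / (1 + `|v|) * `|v| <= e.
    by rewrite mulrAC ler_pdivrMr//; have := mulr_ge0 (ltW e0) (normr_ge0 v); lra.
  rewrite mulrDl; lra.
exists (inf S); split=> //; split; last first.
  by move=> _ [f /clarke_gradient_slope_bound/infle + <-].
have [f fx fS] := slope_bound_clarke_gradient lip Sinf.
exists f => //; apply/le_anti; rewrite fS/=; apply: infle.
exact: clarke_gradient_slope_bound.
Qed.

End ClarkeBounds.

(** * Geodesic distance estimated by straight segments *)

Section Segments.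
Context {R : realType} {X : normedModType R}.
Implicit Types (x y : X) (F : set X).

(** Properness makes the limit in [path_derivative] unique. Nearby points are found to the right of
    [t] in the left half of the interval and to the left otherwise. *)
Lemma within_itv01_dnbhs_proper (t : R) : t \in `[0, 1] ->
  ProperFilter (within `[0, 1] t^').
Proof.
rewrite in_itv/= => /andP[t0 t1]; apply: Build_ProperFilter_ex => B.
move=> /nbhs_ballP[e /= e0 eB].
pose d := Num.min (e / 2) (1 / 2).
have d0 : 0 < d by rewrite lt_min !divr_gt0.
have de : d < e.
  have : d <= e / 2 by rewrite ge_min lexx.
  lra.
have d1 : d <= 1 / 2 by rewrite ge_min lexx orbT.
have [t2|t2] := leP t (1 / 2).
- exists (t + d); apply: eB.
  + by rewrite -ball_normE/= opprD addNKr normrN gtr0_norm.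
  + by apply/eqP; lra.
  + by rewrite /= in_itv/=; lra.
- exists (t - d); apply: eB.
  + by rewrite -ball_normE/= opprB addrC subrK gtr0_norm.
  + by apply/eqP; lra.
  + by rewrite /= in_itv/=; lra.
Qed.

Definition segment_path x y (t : R) : X := x + t *: (y - x).

Lemma segment_path_continuous x y : continuous (segment_path x y).
Proof.
move=> t; apply: cvgD; first exact: cvg_cst.
by apply: cvgZ; [exact: cvg_id|exact: cvg_cst].
Qed.

Lemma cvg_diff_quotient_segment x y (t : R) :
  diff_quotient (segment_path x y) t @ within `[0, 1] t^' --> y - x.
Proof.
apply: cvg_near_cst; rewrite near_withinE; near=> s => _.
have st : s != t by near: s; exact: nbhs_dnbhs_neq.
rewrite /diff_quotient /segment_path opprD addrACA subrr add0r -scalerBl.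
by rewrite scalerA mulVf ?scale1r// subr_eq0.
Unshelve. all: by end_near. Qed.

Lemma path_derivative_segment x y (t : R) : t \in `[0, 1] ->
  path_derivative (segment_path x y) t = y - x.
Proof.
move=> t01; have PF := within_itv01_dnbhs_proper t01.
by apply: cvg_lim => //; exact: cvg_diff_quotient_segment.
Qed.

Lemma C1_segment_path x y : C1_path (segment_path x y).
Proof.
split=> [t _|].
  by apply/cvg_ex; exists (y - x); exact: cvg_diff_quotient_segment.
apply: (@subspace_eq_continuous _ _ _ (fun=> y - x)).
  by move=> t; rewrite inE => t01; rewrite /= [RHS]path_derivative_segment.
by apply: continuous_subspaceT => t; exact: cvg_cst.
Qed.

Lemma path_length_ge0 (c : R -> X) : 0 <= path_length c.
Proof.
apply: Rintegral_ge0 => t _; rewrite divr_ge0// addr_ge0//.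
Qed.

(** Along the segment the norm is at least |x| - |x - y|, so the integrand is bounded by the
    constant on the right. *)
Lemma path_length_segment_le x y : `|x - y| < 1 + `|x| ->
  path_length (segment_path x y) <= `|x - y| / (1 + `|x| - `|x - y|).
Proof.
move=> xy; rewrite /path_length.
have -> : \int[lebesgue_measure]_(t in `[0 : R, 1])
    (`|path_derivative (segment_path x y) t| / (1 + `|segment_path x y t|)) =
  \int[lebesgue_measure]_(t in `[0 : R, 1])
    (`|y - x| / (1 + `|segment_path x y t|)).
  apply: eq_Rintegral => t; rewrite inE => t01.
  by rewrite path_derivative_segment.
have pos t : 0 < 1 + `|segment_path x y t| by rewrite ltr_pwDl.
set M := leRHS.
have -> : M = \int[lebesgue_measure]_(t in `[0 : R, 1]) M.
  rewrite Rintegral_cst//= lebesgue_measure_itv/= lte_fin ltr01/=.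
  by rewrite subr0 mulr1.
apply: le_Rintegral => //.
- apply: continuous_compact_integrable; first exact: segment_compact.
  apply: continuous_subspaceT => t; apply: cvgM; first exact: cvg_cst.
  apply: cvgV; first by rewrite gt_eqF.
  apply: cvgD; first exact: cvg_cst.
  by apply: cvg_norm; exact: segment_path_continuous.
- apply: continuous_compact_integrable; first exact: segment_compact.
  by apply: continuous_subspaceT => t; exact: cvg_cst.
- move=> t /=; rewrite in_itv/= => /andP[t0 t1].
  rewrite /M distrC ler_wpM2l// lef_pV2 ?posrE// ?subr_gt0//.
  rewrite distrC in xy *.
  have : `|x| <= `|segment_path x y t| + `|t *: (y - x)|.
    by rewrite -{1}[x](addrK (t *: (y - x))) ler_normB.
  rewrite normrZ ger0_norm//.
  have : t * `|y - x| <= `|y - x| by rewrite -[leRHS]mul1r ler_wpM2r.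
  lra.
Qed.

Lemma segment_path0 x y : segment_path x y 0 = x.
Proof. by rewrite /segment_path scale0r addr0. Qed.

Lemma segment_path1 x y : segment_path x y 1 = y.
Proof. by rewrite /segment_path scale1r addrC subrK. Qed.

Lemma geodesic_dist_ge0 x y : 0 <= geodesic_dist x y.
Proof.
apply: lb_le_inf; last by move=> _ [c _ <-]; exact: path_length_ge0.
exists (path_length (segment_path x y)), (segment_path x y) => //=.
by rewrite segment_path0 segment_path1; split=> //; exact: C1_segment_path.
Qed.

Lemma geodesic_dist_le x y : `|x - y| < 1 + `|x| ->
  geodesic_dist x y <= `|x - y| / (1 + `|x| - `|x - y|).
Proof.
move=> /path_length_segment_le; apply: le_trans; apply: ge_inf.
  by exists 0 => _ [c _ <-]; exact: path_length_ge0.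
exists (segment_path x y) => //=.
by rewrite segment_path0 segment_path1; split=> //; exact: C1_segment_path.
Qed.

Lemma geodesic_dist_set_ge0 x F : 0 <= geodesic_dist_set x F.
Proof.
have [->|/set0P[y Fy]] := eqVneq F set0.
  by rewrite /geodesic_dist_set image_set0 inf0.
apply: lb_le_inf; first by exists (geodesic_dist x y), y.
by move=> _ [z _ <-]; exact: geodesic_dist_ge0.
Qed.

Lemma geodesic_dist_set_le x y F : F y -> `|x - y| < 1 + `|x| ->
  geodesic_dist_set x F <= `|x - y| / (1 + `|x| - `|x - y|).
Proof.
move=> Fy /geodesic_dist_le; apply: le_trans; apply: ge_inf; last by exists y.
by exists 0 => _ [z _ <-]; exact: geodesic_dist_ge0.
Qed.

End Segments.

Lemma continuous_epsP {R : realType} {V W : normedModType R} (f : V -> W) x :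
  {for x, continuous f} <-> forall e, 0 < e ->
    exists2 d, 0 < d & forall y, `|y - x| < d -> `|f y - f x| < e.
Proof.
split=> [cf e e0|h].
- have /cvgrPdist_lt/(_ e e0)/nbhs_ballP[d /= d0 dh] := cf.
  exists d => // y yx; rewrite distrC; apply: dh.
  by rewrite -ball_normE/= distrC.
- apply/cvgrPdist_lt => e e0; have [d d0 dh] := h e e0.
  apply/nbhs_ballP; exists d => //= y; rewrite -ball_normE/= distrC => yx.
  by rewrite distrC; exact: dh.
Qed.

(** * The Brezis-Browder ordering principle *)

Section OrderPrinciple.
Context {R : realType} {T : Type}.
Variables (S : set T) (le : T -> T -> Prop) (phi : T -> R) (b : R).
Hypotheses (le_refl : forall x, le x x)
  (le_tr : forall x y z, le x y -> le y z -> le x z)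
  (phi_mono : forall x y, le x y -> phi x <= phi y)
  (phi_lb : forall x, S x -> b <= phi x)
  (le_complete : forall u : nat -> T, (forall n, S (u n)) ->
     (forall n, le (u n.+1) (u n)) -> exists2 x, S x & forall n, le x (u n)).

(** Choose [u n.+1] below [u n] with [phi] within 1/(n+1) of its infimum there. A lower bound [x] of
    the sequence works: any [y] below [x] is below every [u n], so phi x <= phi (u n.+1) <= phi y +
    1/(n+1). *)
Lemma brezis_browder c : S c -> exists k, [/\ S k, le k c &
  forall k', S k' -> le k' k -> phi k' = phi k].
Proof.
move=> Sc.
have next (p : nat * T) : exists y, S p.2 -> [/\ S y, le y p.2 &
    forall z, S z -> le z p.2 -> phi y <= phi z + p.1.+1%:R^-1].
  have [Sx|nSx] := pselect (S p.2); last by exists p.2.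
  pose A := [set phi z | z in [set z | S z /\ le z p.2]].
  have infA : has_inf A.
    split; first by exists (phi p.2), p.2.
    by exists b => _ [z [Sz _] <-]; exact: phi_lb.
  have n0 : 0 < p.1.+1%:R^-1 :> R by rewrite invr_gt0.
  have [_ [y [Sy yx] <-] yA] := inf_adherent n0 infA.
  exists y => _; split=> // z Sz zx; apply: ltW; apply: lt_le_trans yA _.
  rewrite lerD2r; apply: ge_inf; first exact: infA.2.
  by exists z.
have [f fP] := choice next.
pose u := fix u n := if n is m.+1 then f (m, u m) else c.
have Su n : S (u n).
  by elim: n => [//|n IH]; have [] := fP (n, u n) IH.
have u_dec n : le (u n.+1) (u n) by have [] := fP (n, u n) (Su n).
have [x Sx xu] := le_complete Su u_dec.
exists x; split=> //; first exact: (xu 0%N).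
move=> y Sy yx; apply/le_anti; rewrite phi_mono//=.
apply/ler_addgt0Pl => e e0.
have [N _ /(_ N (leqnn N)) Ne] := near_infty_natSinv_lt (PosNum e0).
have [_ _ /(_ y Sy (le_tr yx (xu N)))] := fP (N, u N) (Su N).
have := phi_mono (xu N.+1); move: Ne => /= Ne h1 h2.
by apply: le_trans h1 (le_trans h2 _); rewrite addrC lerD2r ltW.
Qed.

End OrderPrinciple.

(** * An order on paths and its completeness *)

Section PathOrder.
Context {R : realType} {X : completeNormedModType R}.
Variables (g : X -> R) (eps : R).
Hypotheses (cg : continuous (g : X -> R^o)) (eps0 : 0 < eps).
Implicit Types (k c : R -> X) (t : R).

Definition path_max k : R := sup [set g (k t) | t in `[0, 1]].

Lemma path_max_attained k : continuous k ->
  (exists2 t, t \in `[0, 1] & g (k t) = path_max k) /\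
  (forall t, t \in `[0, 1] -> g (k t) <= path_max k).
Proof.
move=> ck.
have cgk : {within `[0, 1], continuous (g \o k : R -> R^o)}.
  apply: continuous_subspaceT => t; apply: continuous_comp; first exact: ck.
  exact: cg.
have [t0 t01 tmax] := EVT_max ler01 cgk.
have E : path_max k = g (k t0).
  apply/le_anti/andP; split.
    apply: ge_sup; first by exists (g (k t0)), t0.
    by move=> _ [t t01' <-]; exact: tmax.
  apply: ub_le_sup; last by exists t0.
  by exists (g (k t0)) => _ [t t01' <-]; exact: tmax.
by split=> [|t /tmax]; [exists t0|rewrite E].
Qed.

(* ln (1 + |x - y| / (1 + |x|)) satisfies the triangle inequality, so this is
   the order of Ekeland's principle for a (nonsymmetric) distance whose length
   element is that of the geodesic distance. *)
Definition path_le k' k : Prop := forall t,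
  `|k' t - k t| <= (1 + `|k t|) * (expR ((path_max k - path_max k') / eps) - 1).

Lemma path_le_refl k : path_le k k.
Proof. by move=> t; rewrite !subrr normr0 mul0r expR0 subrr mulr0. Qed.

Lemma path_le_mono k' k : path_le k' k -> path_max k' <= path_max k.
Proof.
move=> /(_ 0) h; have := le_trans (normr_ge0 _) h.
rewrite pmulr_rge0; last by rewrite ltr_pwDl.
by rewrite subr_ge0 -expR0 ler_expR pmulr_lge0 ?invr_gt0// subr_ge0.
Qed.

(** The second relation gives 1 + |k2 t| <= (1 + |k3 t|) exp ((max k3 - max k2) / eps). The
    exponential factors multiply and their exponents telescope. *)
Lemma path_le_trans k1 k2 k3 :
  path_le k1 k2 -> path_le k2 k3 -> path_le k1 k3.
Proof.
move=> h12 h23 t; have := path_le_mono h12; have := path_le_mono h23.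
move=> m23 m12; have := h12 t; have := h23 t.
set p := (_ - _) / eps; set q := (_ - _) / eps.
have -> : (path_max k3 - path_max k1) / eps = p + q by rewrite /p/q; ring.
have q0 : 1 <= expR q.
  by rewrite -expR0 ler_expR divr_ge0// ?subr_ge0// ltW.
rewrite expRD => h3 h2.
have n12 : `|k1 t - k3 t| <= `|k1 t - k2 t| + `|k2 t - k3 t|.
  exact: ler_distD.
have n2 : `|k2 t| <= `|k2 t - k3 t| + `|k3 t|.
  by rewrite -{1}[k2 t](subrK (k3 t)) ler_normD.
have := normr_ge0 (k3 t); nra.
Qed.

(** The maxima decrease to a limit [L], so the relative step sizes [tau n] tend to 0 and [u n t] is
    Cauchy for each [t]. The convergence is locally uniform in [t], so the limit path is
    continuous. *)
Lemma path_le_complete (b : R) (u : nat -> R -> X) :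
  (forall n, continuous (u n)) -> (forall n, b <= path_max (u n)) ->
  (forall n, path_le (u n.+1) (u n)) ->
  exists k, [/\ continuous k, forall t, u n t @[n --> \oo] --> k t &
    forall n, path_le k (u n)].
Proof.
move=> cu ub udec; pose a n := path_max (u n).
have ule n m : (n <= m)%N -> path_le (u m) (u n).
  elim: m => [|m IH]; first by rewrite leqn0 => /eqP->; exact: path_le_refl.
  rewrite leq_eqVlt => /predU1P[->|]; first exact: path_le_refl.
  by rewrite ltnS => /IH h; exact: (path_le_trans (udec m) h).
have a_dec n m : (n <= m)%N -> a m <= a n by move=> /ule/path_le_mono.
pose L := inf [set a n | n in setT].
have infa : has_inf [set a n | n in setT].
  by split; [exists (a 0%N), 0%N|exists b => _ [n _ <-]; exact: ub].
have La n : L <= a n by apply: ge_inf; [exact: infa.2|exists n].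
have aL e : 0 < e -> exists N, forall n, (N <= n)%N -> a n < L + e.
  move=> e0; have [_ [N _ <-] aN] := inf_adherent e0 infa.
  by exists N => n /a_dec; move=> h; exact: le_lt_trans aN.
pose tau n := expR ((a n - L) / eps) - 1.
have tau0 n : 0 <= tau n.
  by rewrite subr_ge0 -expR0 ler_expR divr_ge0// ?subr_ge0// ltW.
have tau_small e : 0 < e -> exists N, forall n, (N <= n)%N -> tau n < e.
  move=> e0; have l0 : 0 < ln (1 + e) by rewrite ln_gt0// ltrDl.
  have [N hN] := aL _ (mulr_gt0 l0 eps0); exists N => n /hN h.
  rewrite /tau ltrBlDl -[1 + e]lnK ?posrE ?addr_gt0// ltr_expR.
  by rewrite ltr_pdivrMr//; lra.
have step n m t : (n <= m)%N ->
    `|u m t - u n t| <= (1 + `|u n t|) * tau n.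
  move=> nm; apply: le_trans (ule _ _ nm t) _.
  rewrite ler_wpM2l ?addr_ge0// lerD2r ler_expR ler_wpM2r//.
    by rewrite invr_ge0 ltW.
  by rewrite lerD2l lerN2 La.
pose B t := (1 + `|u 0%N t|) * (1 + tau 0%N).
have B0 t : 0 < B t by rewrite mulr_gt0// ltr_pwDl.
have bnd n t : 1 + `|u n t| <= B t.
  have := step 0%N n t (leq0n n).
  have : `|u n t| <= `|u n t - u 0%N t| + `|u 0%N t|.
    by rewrite -{1}[u n t](subrK (u 0%N t)) ler_normD.
  rewrite /B; nra.
have stepB n m t : (n <= m)%N -> `|u m t - u n t| <= B t * tau n.
  by move=> /step h; apply: le_trans (h t) _; rewrite ler_wpM2r.
have cvgu t : cvg (u n t @[n --> \oo]).
  apply: cauchy_cvg; apply: cauchy_exP => e e0.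
  have [N hN] := tau_small _ (divr_gt0 e0 (B0 t)).
  exists (u N t); exists N => //= n /= Nn.
  rewrite -ball_normE/= distrC; apply: le_lt_trans (stepB _ _ _ Nn) _.
  by rewrite mulrC -ltr_pdivlMr// hN.
pose k t := lim (u n t @[n --> \oo]).
have uk t : u n t @[n --> \oo] --> k t by exact: cvgu.
have near_k t e n : 0 < e -> exists2 m, (n <= m)%N & `|u m t - k t| < e.
  move=> e0; have /cvgrPdist_lt/(_ e e0)[N _ hN] := uk t.
  exists (maxn n N); first exact: leq_maxl.
  by rewrite distrC; apply: hN; exact: leq_maxr.
have kstep n t : `|k t - u n t| <= (1 + `|u n t|) * tau n.
  apply/ler_addgt0Pl => e e0; have [m nm hm] := near_k t e n e0.
  have := step _ _ t nm.
  have : `|k t - u n t| <= `|k t - u m t| + `|u m t - u n t|.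
    exact: ler_distD.
  rewrite (distrC (k t) (u m t)); lra.
have kstepB n t : `|k t - u n t| <= B t * tau n.
  by apply: le_trans (kstep _ _) _; rewrite ler_wpM2r.
have ck : continuous k.
  move=> t; apply/(@continuous_epsP _ R^o) => e e0.
  (* [C] bounds [B s] wherever [u 0 s] is within 1 of [u 0 t], which makes the tail estimate uniform
     near [t]. *)
  pose C := (2 + `|u 0%N t|) * (1 + tau 0%N).
  have C0 : 0 < C by rewrite mulr_gt0// ltr_pwDl.
  have tau1 : 0 <= 1 + tau 0%N by have := tau0 0%N; lra.
  have [N hN] := tau_small _ (divr_gt0 (divr_gt0 e0 (ltr0n R 3)) C0).
  have CN : C * tau N < e / 3 by rewrite mulrC -ltr_pdivlMr// hN.
  have /(@continuous_epsP _ R^o)/(_ 1 ltr01)[d1 d10 h1] := cu 0%N t.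
  have /(@continuous_epsP _ R^o)/(_ _ (divr_gt0 e0 (ltr0n R 3)))[d2 d20 h2]
    := cu N t.
  exists (Num.min d1 d2); first by rewrite lt_min d10.
  move=> s; rewrite lt_min => /andP[/h1 s1 /h2 s2].
  have BC : B s <= C.
    rewrite /B /C ler_wpM2r//.
    have := ler_normD (u 0%N s - u 0%N t) (u 0%N t); rewrite subrK; lra.
  have BC' : B t <= C by rewrite /B /C ler_wpM2r//; lra.
  have := kstepB N s; have := kstepB N t.
  have := ler_wpM2r (tau0 N) BC; have := ler_wpM2r (tau0 N) BC'.
  have := ler_distD (u N s) (k s) (k t); have := ler_distD (u N t) (u N s) (k t).
  rewrite (distrC (u N t) (k t)); lra.
exists k; split=> // n t; apply: le_trans (kstep n t) _.
rewrite ler_wpM2l ?addr_ge0// lerD2r ler_expR ler_wpM2r//.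
  by rewrite invr_ge0 ltW.
(* It remains to see that [path_max k <= L]. At a maximum point [t0] of [g] along [k], g (k t0) is
   close to g (u m t0) <= a m, which is close to L. *)
rewrite lerD2l lerN2; apply/ler_addgt0Pl => e e0.
have [[t0 t01 <-] _] := path_max_attained ck.
have e20 : 0 < e / 2 by rewrite divr_gt0.
have [d d0 hd] :=
  (continuous_epsP (g : X -> R^o) (k t0)).1 (@cg (k t0)) _ e20.
have [N hN] := aL _ e20; have [m Nm hm] := near_k t0 d N d0.
have := hd _ hm; have := (path_max_attained (cu m)).2 _ t01.
rewrite ltr_norml => gm /andP[+ _]; move: (hN m Nm); rewrite /a; lra.
Qed.

End PathOrder.

Lemma continuous_maxl {R : realType} {T : topologicalType} (a : R)
    (f : T -> R) : continuous f -> continuous (fun x => Num.max a (f x)).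
Proof.
move=> cf x.
exact: (@continuous_max R T (fun=> a) f x (@cvg_cst _ _ _ _ _) (@cf x)).
Qed.

Lemma continuous_minl {R : realType} {T : topologicalType} (a : R)
    (f : T -> R) : continuous f -> continuous (fun x => Num.min a (f x)).
Proof.
move=> cf x.
exact: (@continuous_min R T (fun=> a) f x (@cvg_cst _ _ _ _ _) (@cf x)).
Qed.

(** * Gluing local descent directions along a path *)

Section Deformation.
Context {R : realType} {X : normedModType R}.
Implicit Types (g : X -> R) (k : R -> X) (t h a : R) (D U : set R).

(** One direction [v] must serve all [w] near [x], so that it still works after earlier
    displacements. Its size is measured in the scale 1 + |w| of [path_le]. *)
Definition descent_at g a (x : X) : Prop := exists v, exists2 rho, 0 < rho &
  forall w, `|w - x| < rho -> `|v| <= 2 * (1 + `|w|) /\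
    forall h, 0 < h -> h < rho -> g (w + h *: v) <= g w - a * h.

(** The weight [s] is the fraction of the push applied at each parameter: full on [D], none outside
    [U]. Displacement and decrease are both proportional to [h * s t]. *)
Definition deforms g a k U D (s : R -> R) : Prop :=
  [/\ continuous s, forall t, 0 <= s t <= 1, forall t, D t -> s t = 1,
      forall t, ~ U t -> s t = 0 &
      exists2 h0, 0 < h0 & forall h, 0 < h -> h < h0 -> exists k',
        [/\ continuous k',
            forall t, `|k' t - k t| <= 2 * h * s t * (1 + `|k t|) &
            forall t, g (k' t) <= g (k t) - a * h * s t]].

Definition bump t0 r t : R := Num.max 0 (Num.min 1 (2 - 2 * (`|t - t0| / r))).

Lemma bump_continuous t0 r : continuous (bump t0 r).
Proof.
apply: continuous_maxl; apply: continuous_minl => t.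
apply: cvgB; first exact: cvg_cst.
apply: cvgM; first exact: cvg_cst.
apply: cvgM; last exact: cvg_cst.
apply: cvg_norm; apply: cvgB; [exact: cvg_id|exact: cvg_cst].
Qed.

Lemma bump_ge0 t0 r t : 0 <= bump t0 r t.
Proof. by rewrite le_max lexx. Qed.

Lemma bump_eq1 t0 r t : 0 < r -> `|t - t0| < r / 2 -> bump t0 r t = 1.
Proof.
move=> r0 tr; rewrite /bump min_l; first by rewrite max_r.
have : `|t - t0| / r <= 1 / 2 by rewrite ler_pdivrMr//; lra.
lra.
Qed.

Lemma bump_eq0 t0 r t : 0 < r -> r <= `|t - t0| -> bump t0 r t = 0.
Proof.
move=> r0 tr; rewrite /bump max_l// ge_min; apply/orP; right.
have : 1 <= `|t - t0| / r by rewrite ler_pdivlMr//; lra.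
lra.
Qed.

(* Adding s' := min (1, s + bump) - s along the new direction keeps the total
   displacement bounded by the total decrease without a partition of unity. *)
Lemma deforms_setU g a k U t0 : continuous k -> open U -> U t0 ->
  descent_at g a (k t0) ->
  exists2 r, 0 < r & forall D s, deforms g a k U D s ->
    exists s', deforms g a k U (D `|` ball t0 r) s'.
Proof.
move=> ck oU Ut0 [v [rho rho0 hv]].
have [d1 /= d10 d1U] := (nbhs_ballP _ _).1 (open_nbhs_nbhs (conj oU Ut0)).
have rho20 : 0 < rho / 2 by rewrite divr_gt0.
have [d2 d20 hd2] :=
  (continuous_epsP (k : R^o -> X) t0).1 (@ck t0) _ rho20.
pose r := Num.min d1 d2; have r0 : 0 < r by rewrite lt_min d10.
exists (r / 2) => [|D s [cs s01 sD sU [h0 h00 hk]]]; first by rewrite divr_gt0.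
pose s' t := Num.min 1 (s t + bump t0 r t); exists s'.
have cs' : continuous s'.
  apply: continuous_minl => t.
  by apply: cvgD; [exact: cs|exact: bump_continuous].
have s's t : s t <= s' t.
  by rewrite le_min (andP (s01 t)).2 lerDl bump_ge0.
have s'1 t : s' t <= 1 by rewrite ge_min lexx.
have s0 t : 0 <= s t by case/andP: (s01 t).
have far t : r <= `|t - t0| -> s' t = s t.
  move=> tr; rewrite /s' bump_eq0// addr0 min_r//.
  by case/andP: (s01 t).
split=> //.
- by move=> t; rewrite s'1 andbT (le_trans (s0 t)).
- move=> t [/sD st|].
    by apply/le_anti; rewrite s'1 -{1}st s's.
  rewrite -ball_normE/= distrC => tr.
  by rewrite /s' bump_eq1// min_l// lerDr.
- move=> t nU; rewrite far ?sU// leNgt; apply/negP => tr; apply: nU.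
  apply: d1U; rewrite -ball_normE/= distrC; apply: lt_le_trans tr _.
  by rewrite ge_min lexx.
(* [C] bounds 1 + |k t| near [t0], so h < rho / (4 C) keeps the earlier displacement below rho / 2,
   and [k' t] stays in the ball where [v] descends. *)
pose C := 1 + `|k t0| + rho.
have C0 : 0 < C by rewrite /C; have := normr_ge0 (k t0); lra.
exists (Num.min h0 (Num.min rho (rho / (4 * C)))).
  by rewrite !lt_min h00 rho0 divr_gt0// mulr_gt0.
move=> h hp; rewrite !lt_min => /and3P[hh0 hrho].
rewrite ltr_pdivlMr ?mulr_gt0// => hC.
have [k' [ck' k'k gk']] := hk h hp hh0.
exists (fun t => k' t + (h * (s' t - s t)) *: v); split.
- move=> t; apply: cvgD; first exact: ck'.
  apply: cvgZ; last exact: cvg_cst.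
  apply: cvgM; first exact: cvg_cst.
  by apply: cvgB; [exact: cs'|exact: cs].
- move=> t; have [/far ->|tr] := leP r `|t - t0|.
    by rewrite subrr mulr0 scale0r addr0.
  have kt : `|k t - k t0| < rho.
    have : `|k t - k t0| < rho / 2.
      by apply: hd2; apply: lt_le_trans tr _; rewrite ge_min lexx orbT.
    lra.
  have [vk _] := hv _ kt.
  rewrite addrAC; apply: le_trans (ler_normD _ _) _.
  have hs : 0 <= h * (s' t - s t) by rewrite mulr_ge0 ?subr_ge0// ltW.
  rewrite normrZ ger0_norm//; have := ler_wpM2l hs vk; have := k'k t; lra.
- move=> t; have [/far ->|tr] := leP r `|t - t0|.
    by rewrite subrr mulr0 scale0r addr0.
  have [->|s'n] := eqVneq (s' t) (s t).
    by rewrite subrr mulr0 scale0r addr0.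
  have ds : 0 < s' t - s t by rewrite subr_gt0 lt_def s'n s's.
  have kt : `|k t - k t0| < rho / 2.
    by apply: hd2; apply: lt_le_trans tr _; rewrite ge_min lexx orbT.
  have k't : `|k' t - k t0| < rho.
    have := ler_distD (k t) (k' t) (k t0).
    have k1 : 1 + `|k t| <= C.
      have := ler_normD (k t - k t0) (k t0); rewrite subrK /C; lra.
    have : 2 * h * s t * (1 + `|k t|) <= 2 * h * C.
      have /ler_wpM2l : 0 <= 2 * h by lra.
      rewrite -mulrA; apply; rewrite -[leRHS]mul1r.
      have s1 : s t <= 1 by case/andP: (s01 t).
      by apply: ler_pM => //; rewrite addr_ge0.
    have := k'k t; lra.
  have [_ hg] := hv _ k't.
  have d1' : s' t - s t <= 1 by have := s'1 t; have := s0 t; lra.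
  have := hg (h * (s' t - s t)); rewrite mulr_gt0// => /(_ isT).
  have -> : h * (s' t - s t) < rho.
    by apply: le_lt_trans hrho; rewrite -[leRHS]mulr1 ler_wpM2l// ltW.
  move=> /(_ isT); have := gk' t; lra.
Qed.

(** The radius given by [deforms_setU] does not depend on [D] and [s]. So finitely many balls cover
    [K], and they are added one at a time, starting from the zero weight. *)
Lemma deforms_compact g a k (K U : set R) : continuous k -> compact K ->
  open U -> K `<=` U -> (forall t, K t -> descent_at g a (k t)) ->
  exists D s, [/\ open D, K `<=` D & deforms g a k U D s].
Proof.
move=> ck cK oU KU hK.
have /choice[r hr] t : exists r, K t -> 0 < r /\ forall D s,
    deforms g a k U D s -> exists s', deforms g a k U (D `|` ball t r) s'.
  have [Kt|nKt] := pselect (K t); last by exists 0.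
  by have [r r0 h] := deforms_setU ck oU (KU _ Kt) (hK _ Kt); exists r.
have [] := (_ : cover_compact K) R K (fun t => ball t (r t)).
- by rewrite -compact_cover.
- by move=> t /hr[r0 _]; exact: ball_open.
- by move=> t Kt; exists t => //; apply: ballxx; have [] := hr t Kt.
move=> D' D'K KD'.
pose V (l : seq R) := \bigcup_(t in [set t | t \in l]) ball t (r t).
suff glue l : {subset l <= K} -> exists s, deforms g a k U (V l) s.
  have [s hs] := glue (finmap.enum_fset D') D'K.
  exists (V (finmap.enum_fset D')), s.
  split=> //; apply: bigcup_open => t /= tD'.
  by have [r0 _] := hr t (set_mem (D'K _ tD')); exact: ball_open.
elim: l => [_|t l IH lK].
  exists (fun=> 0); split=> //.
  - by move=> t; exact: cvg_cst.
  - by move=> t; rewrite lexx ler01.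
  - by move=> t [].
  - exists 1 => // h _ _; exists k; split=> // t.
      by rewrite subrr normr0 mulr0 mul0r.
    by rewrite mulr0 subr0.
have [|s hs] := IH; first by move=> x xl; apply: lK; rewrite inE xl orbT.
have [_ /(_ _ _ hs)[s' hs']] := hr t (set_mem (lK t (mem_head _ _))).
exists s'; congr (deforms _ _ _ _ _ _): hs'.
apply/seteqP; split=> [x [[t' /= t'l xt']|xt]|x [t' /=]].
- by exists t' => //=; rewrite inE t'l orbT.
- by exists t => //=; rewrite mem_head.
- by rewrite inE => /predU1P[->|t'l] xt'; [right|left; exists t'].
Qed.

End Deformation.

(** * A path of minimal maximum has a maximum point without fast descent *)

Section MinimalPath.
Context {R : realType} {X : completeNormedModType R}.
Variables (g : X -> R) (eps : R).
Hypotheses (cg : continuous (g : X -> R^o)) (eps0 : 0 < eps).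

Lemma minimal_path_no_descent (k : R -> X) (A : set R) : continuous k ->
  closed A -> (forall t, t \in `[0, 1] -> A t -> g (k t) < path_max g k) ->
  (forall k', continuous k' -> (forall t, A t -> k' t = k t) ->
     path_le g eps k' k -> path_max g k' = path_max g k) ->
  exists t, [/\ t \in `[0, 1], g (k t) = path_max g k &
    ~ descent_at g (2 * eps) (k t)].
Proof.
move=> ck cA Amax kmin; apply: contrapT => nex.
have cgk : continuous (g \o k : R -> R^o).
  by move=> t; apply: continuous_comp; [exact: ck|exact: cg].
have [[tm tm01 gtm] gle] := path_max_attained cg ck.
pose K := `[0 : R, 1] `&` (g \o k) @^-1` [set path_max g k].
have cK : compact K.
  apply: (@subclosed_compact _ _ `[0 : R, 1]); last exact: subIsetl.
    apply: closedI; first exact: interval_closed.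
    by apply: closed_comp; [move=> t _; exact: cgk|exact: closed_eq].
  exact: segment_compact.
have KA : K `<=` ~` A.
  by move=> t [t01 /= gt] At; have := Amax t t01 At; rewrite gt ltxx.
have Kdesc t : K t -> descent_at g (2 * eps) (k t).
  by move=> [t01 gt]; apply: contrapT => nd; apply: nex; exists t.
have oA : open (~` A) by exact: closed_openC.
have [D [s [oD KD [cs s01 sD sA [h0 h00 hk]]]]] :=
  deforms_compact ck cK oA KA Kdesc.
(* The part of [0, 1] outside [D] is compact and contains no maximum point, hence the gap [eta]. *)
have [eta eta0 heta] : exists2 eta, 0 < eta &
    forall t, t \in `[0 : R, 1] -> ~ D t -> g (k t) <= path_max g k - eta.
  have [E|/set0P ne] := eqVneq (`[0 : R, 1] `\` D) set0.
    by exists 1 => // t t01 nD; suff : set0 t by []; rewrite -E.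
  have cD : compact (`[0 : R, 1] `\` D).
    apply: (@subclosed_compact _ _ `[0 : R, 1]); last exact: subIsetl.
      by apply: closedI; [exact: interval_closed|exact: open_closedC].
    exact: segment_compact.
  have [t0] := compact_EVT_max ne cD (continuous_subspaceT cgk).
  rewrite inE => -[t001 nD0] h.
  have lt0 : g (k t0) < path_max g k.
    rewrite lt_neqAle gle// andbT; apply/eqP => E; apply: nD0.
    by apply: KD; split.
  exists (path_max g k - g (k t0)); first by rewrite subr_gt0.
  by move=> t t01 nD; rewrite subKr; apply: h; rewrite inE; split.
(* With 2 eps h < eta, parameters outside [D] are already lower than the level reached on [D]. *)
pose h := Num.min h0 (eta / (2 * eps)) / 2.
have m0 : 0 < Num.min h0 (eta / (2 * eps)).
  by rewrite lt_min h00 divr_gt0// mulr_gt0.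
have hp : 0 < h by rewrite divr_gt0.
have hm : h < Num.min h0 (eta / (2 * eps)) by rewrite /h; lra.
move: hm; rewrite lt_min ltr_pdivlMr ?mulr_gt0// => /andP[hh0 heta2].
have [k' [ck' k'k gk']] := hk h hp hh0.
have drop : path_max g k' <= path_max g k - 2 * eps * h.
  have [[t t01 <-] _] := path_max_attained cg ck'.
  have := gk' t; have [/sD ->|nD] := pselect (D t).
    by have := gle t t01; lra.
  have := heta t t01 nD; case/andP: (s01 t) => s0 _.
  have := mulr_ge0 (mulr_ge0 (ltW (mulr_gt0 (ltr0Sn R 1) eps0)) (ltW hp)) s0; lra.
have : path_max g k' = path_max g k.
  apply: kmin => //.
    move=> t At; apply/eqP; rewrite -subr_eq0 -normr_le0.
    by have := k'k t; rewrite sA ?mulr0 ?mul0r//; apply.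
  move=> t; apply: le_trans (k'k t) _; rewrite mulrC ler_wpM2l ?addr_ge0//.
  have : 2 * h <= (path_max g k - path_max g k') / eps.
    by rewrite ler_pdivlMr//; lra.
  have := expR_ge1Dx ((path_max g k - path_max g k') / eps).
  case/andP: (s01 t) => s0 s1.
  have : 2 * h * s t <= 2 * h by rewrite -[leRHS]mulr1 ler_wpM2l//; lra.
  lra.
have := mulr_gt0 (mulr_gt0 (ltr0Sn R 1) eps0) hp; lra.
Qed.

End MinimalPath.

(** * Relative distance to a set and the penalty *)

Section RelativeDistance.
Context {R : realType} {X : normedModType R}.
Variable M : set X.
Hypothesis M0 : M !=set0.
Implicit Types (x y v w : X) (eps h : R).

Definition dist x : R := inf [set `|x - y| | y in M].

Lemma has_inf_dist x : has_inf [set `|x - y| | y in M].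
Proof.
have [y My] := M0; split; first by exists `|x - y|, y.
by exists 0 => _ [z _ <-].
Qed.

Lemma dist_ge0 x : 0 <= dist x.
Proof. by apply: lb_le_inf; [exact: (has_inf_dist x).1|move=> _ [y _ <-]]. Qed.

Lemma dist_le x y : M y -> dist x <= `|x - y|.
Proof. by move=> My; apply: ge_inf; [exact: (has_inf_dist x).2|exists y]. Qed.

Lemma dist_leD x y : dist x <= dist y + `|x - y|.
Proof.
rewrite -lerBlDr; apply: lb_le_inf; first exact: (has_inf_dist y).1.
move=> _ [z Mz <-]; have := dist_le x Mz; have := ler_distD y x z; lra.
Qed.

Lemma dist_lt x e : dist x < e -> exists2 y, M y & `|x - y| < e.
Proof.
by move=> /(inf_lt (has_inf_dist x).1)[_ [y My <-] xy]; exists y.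
Qed.

Lemma dist_gt0 x : closed M -> ~ M x -> 0 < dist x.
Proof.
move=> cM nMx; have /nbhs_ballP[e /= e0 eM] : nbhs x (~` M).
  by apply: open_nbhs_nbhs; split; [exact: closed_openC|].
apply: lt_le_trans e0 _; apply: lb_le_inf; first exact: (has_inf_dist x).1.
move=> _ [y My <-]; rewrite leNgt; apply/negP => xy.
by apply: (eM y) => //; rewrite -ball_normE.
Qed.

Lemma dist_continuous : continuous (dist : X -> R^o).
Proof.
move=> x; apply/continuous_epsP => e e0; exists e => // y yx.
rewrite ltr_norml; have := dist_leD x y; have := dist_leD y x.
rewrite (distrC x y); lra.
Qed.

Definition rel_dist x : R := dist x / (1 + `|x|).

Lemma rel_dist_ge0 x : 0 <= rel_dist x.
Proof. by rewrite divr_ge0 ?dist_ge0// addr_ge0. Qed.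

Lemma rel_distK x : rel_dist x * (1 + `|x|) = dist x.
Proof. by rewrite divfK// gt_eqF// ltr_pwDl. Qed.

Lemma rel_dist_continuous : continuous (rel_dist : X -> R^o).
Proof.
move=> x; apply: cvgM; first exact: dist_continuous.
apply: cvgV; first by rewrite gt_eqF// ltr_pwDl.
by apply: cvgD; [exact: cvg_cst|exact: cvg_norm].
Qed.

Definition penalty eps x : R := eps * Num.max 0 (eps - rel_dist x).

Lemma penalty_continuous eps : continuous (penalty eps : X -> R^o).
Proof.
move=> x; apply: cvgM; first exact: cvg_cst.
have := @continuous_maxl R X 0 (fun y => eps - rel_dist y).
by apply=> y; apply: cvgB; [exact: cvg_cst|exact: rel_dist_continuous].
Qed.

Lemma penalty_on eps x : 0 < eps -> M x -> penalty eps x = eps ^+ 2.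
Proof.
move=> e0 Mx; have d0 : dist x = 0.
  apply/le_anti; rewrite dist_ge0 andbT.
  by have := dist_le x Mx; rewrite subrr normr0.
by rewrite /penalty /rel_dist d0 mul0r subr0 max_r// ltW.
Qed.

Lemma penalty_eq0 eps x : eps <= rel_dist x -> penalty eps x = 0.
Proof. by move=> ex; rewrite /penalty max_l ?mulr0// subr_le0. Qed.

Lemma penalty_ge0 eps x : 0 < eps -> 0 <= penalty eps x.
Proof. by move=> e0; rewrite mulr_ge0 ?le_max ?lexx// ltW. Qed.

Lemma penalty_le eps x : 0 < eps -> penalty eps x <= eps ^+ 2.
Proof.
move=> e0; rewrite expr2 ler_pM2l// ge_max ltW//=.
by have := rel_dist_ge0 x; lra.
Qed.

(** If the penalty at [w'] is positive, then [rel_dist w'] is below eps <= 1. Passing from [w'] to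
    [w] then raises the relative distance by at most 4 h: 2 h from the numerator and 2 h from the
    denominator. *)
Lemma penalty_leD eps h w v : 0 < eps -> eps <= 1 -> 0 <= h ->
  `|v| <= 2 * (1 + `|w|) ->
  penalty eps (w + h *: v) <= penalty eps w + 4 * eps * h.
Proof.
move=> e0 e1 h0 vw; set w' := w + h *: v.
have [ew|we] := leP eps (rel_dist w').
  rewrite (penalty_eq0 ew) addr_ge0 ?penalty_ge0//.
  by rewrite !mulr_ge0// ltW.
have w0 : 0 < 1 + `|w| by rewrite ltr_pwDl.
have nhv : `|h *: v| <= h * (2 * (1 + `|w|)).
  by rewrite normrZ ger0_norm// ler_wpM2l.
have ww : `|w - w'| = `|h *: v| by rewrite /w' opprD addNKr normrN.
have w'w : `|w'| <= `|w| + `|h *: v| by exact: ler_normD.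
have uw : rel_dist w <= rel_dist w' + 4 * h.
  rewrite -(ler_pM2r w0) rel_distK.
  have := dist_leD w w'; rewrite ww -(rel_distK w').
  have u0 := rel_dist_ge0 w'.
  have : rel_dist w' * (1 + `|w'|) <=
      rel_dist w' * (1 + (`|w| + h * (2 * (1 + `|w|)))).
    by apply: ler_wpM2l => //; lra.
  have : rel_dist w' * (h * (2 * (1 + `|w|))) <= 1 * (h * (2 * (1 + `|w|))).
    by apply: ler_wpM2r; [rewrite !mulr_ge0// ltW|lra].
  lra.
rewrite /penalty [X in X <= _](_ : _ = eps * (eps - rel_dist w')); last first.
  by rewrite max_r// subr_ge0 ltW.
have : eps - rel_dist w <= Num.max 0 (eps - rel_dist w).
  by rewrite le_max lexx orbT.
move=> /(ler_wpM2l (ltW e0)).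
have := ler_wpM2l (ltW e0) uw; lra.
Qed.

End RelativeDistance.

(** From exp (- s) >= 1 - s one gets exp s * (1 - s) <= 1, and 1 <= (1 + 2 s)(1 - s) on this
    range. *)
Lemma expR_le_1D2x {R : realType} (s : R) :
  0 <= s -> s <= 1 / 2 -> expR s <= 1 + 2 * s.
Proof.
move=> s0 s1; have := expR_ge1Dx (- s); rewrite expRN => h.
have e0 := expR_gt0 s.
have : expR s * (1 - s) <= 1.
  by rewrite -ler_pdivlMl// mulr1.
nra.
Qed.

(** * Crossing a separating set and nearly optimal paths *)

Section Crossing.
Context {R : realType} {X : normedModType R}.
Implicit Types (S : set X) (k c : R -> X) (Phi : X -> R) (z : X).

(** A path avoiding [S] would make the preimage of [U0] clopen in [0, 1], containing 0 but not 1. *)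
Lemma separates_crossing S z0 z1 k : separates S z0 z1 -> continuous k ->
  k 0 = z0 -> k 1 = z1 -> exists2 t, t \in `[0 : R, 1] & S (k t).
Proof.
move=> [_ [U0 [U1 [SO oO0 oO1 O01 [Oz0 Oz1]]]]] ck k0 k1.
apply: contrapT => nex.
have O t : t \in `[0 : R, 1] -> (U0 `|` U1) (k t).
  by move=> t01; rewrite -SO => St; apply: nex; exists t.
have disj x : U0 x -> U1 x -> False.
  by move=> h0 h1; suff : set0 x by []; rewrite -O01.
have k_open U : open U -> open (k @^-1` U).
  by move=> oU; apply: open_comp => // t _; exact: ck.
suff E : `[0 : R, 1] `&` k @^-1` U0 = [set` `[0 : R, 1]].
  have [_ /= Ok1] : (`[0 : R, 1] `&` k @^-1` U0) 1.
    by rewrite E /= in_itv/= lexx ler01.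
  by apply: (disj (k 1)) => //; rewrite k1.
apply: segment_connected.
- by exists 0; split; rewrite /= ?in_itv/= ?lexx ?ler01 ?k0.
- by exists (k @^-1` U0) => //; exact: k_open.
- exists (~` (k @^-1` U1)); first by apply: open_closedC; exact: k_open.
  apply/seteqP; split=> t [t01 /=]; first by split=> // h; exact: disj h.
  by move=> nO1; split=> //; have [] := O t t01.
Qed.

(** Retraction of the line onto [0, 1]; it turns paths continuous on [0, 1] into paths continuous on
    all of R, the form used in the order argument. *)
Definition clip01 (t : R) : R := Num.max 0 (Num.min 1 t).

Lemma clip01_in t : clip01 t \in `[0, 1].
Proof.
by rewrite in_itv/= le_max lexx/= ge_max ler01 ge_min lexx.
Qed.

Lemma clip01_id t : t \in `[0, 1] -> clip01 t = t.
Proof. by rewrite in_itv/= => /andP[t0 t1]; rewrite /clip01 min_r// max_r. Qed.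

Lemma continuous_comp_clip01 c : {within `[0 : R, 1], continuous c} ->
  continuous (c \o clip01).
Proof.
move=> /subspace_continuousP cc t.
have cclip : continuous clip01.
  by apply: continuous_maxl; apply: continuous_minl => s; exact: cvg_id.
move=> U /= cU; have h := @cclip t _ (cc _ (clip01_in t) _ cU).
apply: (@filterS _ (nbhs t) _ _ _ _ h) => s /= hs.
exact: (hs (clip01_in s)).
Qed.

Lemma near_optimal_path Phi z0 z1 e : continuous (Phi : X -> R^o) -> 0 < e ->
  exists k, [/\ continuous k, k 0 = z0, k 1 = z1 &
    forall t, t \in `[0, 1] -> Phi (k t) < minimax_level Phi z0 z1 + e].
Proof.
move=> cPhi e0; pose A := [set m | exists2 c, continuous_paths z0 z1 c &
  is_max [set Phi (c t) | t in `[0 : R, 1]] m].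
have infA : has_inf A.
  split; last first.
    exists (Phi z0) => m [c [_ c0 _] [_ cm]]; apply: cm; exists 0.
      by rewrite /= in_itv/= lexx ler01.
    by rewrite c0.
  have cs := @segment_path_continuous _ _ z0 z1.
  have cPs : {within `[0, 1], continuous (Phi \o segment_path z0 z1)}.
    apply: continuous_subspaceT => t.
    by apply: continuous_comp; [exact: cs|exact: cPhi].
  have [t0 t01 tmax] := EVT_max ler01 cPs.
  exists (Phi (segment_path z0 z1 t0)), (segment_path z0 z1).
    split; [exact: continuous_subspaceT|exact: segment_path0|].
    exact: segment_path1.
  by split; [exists t0|move=> _ [t t01' <-]; exact: tmax].
have [m [c [cc c0 c1] [_ cm]] me] := inf_adherent e0 infA.
exists (c \o clip01); split.
- exact: continuous_comp_clip01.
- by rewrite /= clip01_id ?in_itv/= ?lexx ?ler01.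
- by rewrite /= clip01_id ?in_itv/= ?lexx ?ler01.
- move=> t t01; apply: le_lt_trans me; apply: cm.
  by exists (clip01 t); first exact: clip01_in.
Qed.

End Crossing.

(** * Existence of an almost critical point near the separating set *)

Section AlmostCritical.
Context {R : realType} {X : completeNormedModType R}.
Variables (Phi : X -> R) (M : set X) (z0 z1 : X) (gamma : R).
Hypotheses (lip : locally_lipschitz Phi) (M0 : M !=set0)
  (Mgamma : forall x, M x -> gamma <= Phi x)
  (Mcross : forall k : R -> X, continuous k -> k 0 = z0 -> k 1 = z1 ->
     exists2 t, t \in `[0 : R, 1] & M (k t)).

Lemma almost_critical_point eps (c : R -> X) : 0 < eps -> eps <= 1 ->
  eps <= rel_dist M z0 -> eps <= rel_dist M z1 ->
  continuous c -> c 0 = z0 -> c 1 = z1 ->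
  (forall t, t \in `[0, 1] -> Phi (c t) < gamma + eps ^+ 2 / 4) ->
  exists x, [/\ rel_dist M x <= 3 * eps, gamma <= Phi x,
    Phi x <= gamma + 2 * eps ^+ 2 & slope_bound Phi x (6 * eps / (1 + `|x|))].
Proof.
move=> e0 e1 ez0 ez1 cc c0 c1 cgamma.
have cPhi := locally_lipschitz_continuous lip.
pose g x := Phi x + penalty M eps x.
have cg : continuous (g : X -> R^o).
  by move=> x; apply: cvgD; [exact: cPhi|exact: penalty_continuous].
have ee : 0 < eps ^+ 2 by rewrite exprn_gt0.
(* Parameters to be frozen. They include both endpoints, so competing paths still join z0 to z1, and
   the penalty vanishes on them, so they stay below the maximum. *)
pose A := `[0 : R, 1] `&` [set t | eps <= rel_dist M (c t)].
have cA : closed A.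
  apply: closedI; first exact: interval_closed.
  have cu : continuous (rel_dist M \o c : R -> R^o).
    move=> t; apply: continuous_comp; first exact: cc.
    exact: rel_dist_continuous.
  exact: (closed_comp (fun t _ => @cu t) (@closed_ge R eps)).
have A0 : A 0 by split; rewrite /= ?c0// in_itv/= lexx ler01.
have A1 : A 1 by split; rewrite /= ?c1// in_itv/= lexx ler01.
pose S := [set k : R -> X | continuous k /\ forall t, A t -> k t = c t].
have S_lb k : S k -> gamma + eps ^+ 2 <= path_max g k.
  move=> [ck kA]; have [||t t01 Mt] := Mcross ck; rewrite ?kA//.
  apply: le_trans ((path_max_attained cg ck).2 _ t01).
  by rewrite /g (penalty_on M0 e0 Mt) lerD2r Mgamma.
have [k [[ck kA] kc kmin]] : exists k, [/\ S k, path_le g eps k c &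
    forall k', S k' -> path_le g eps k' k -> path_max g k' = path_max g k].
  apply: (@brezis_browder _ _ S (path_le g eps) (path_max g)
    (gamma + eps ^+ 2)) => //.
  - by move=> k; exact: path_le_refl.
  - by move=> k1 k2 k3; exact: path_le_trans.
  - by move=> k1 k2; exact: path_le_mono.
  - move=> u Su udec.
    have [|n|k [ck uk ku]] := path_le_complete cg e0 (b := gamma + eps ^+ 2)
      _ _ udec; [by move=> n; exact: (Su n).1|exact: S_lb|].
    exists k => //; split=> // t At.
    have E : (fun n => u n t) = fun=> c t.
      by apply/funext => n; exact: (Su n).2.
    have <- : lim (u n t @[n --> \oo]) = k t by apply: cvg_lim => //; exact: uk.
    by rewrite E; apply: cvg_lim => //; exact: cvg_cst.
have Amax t : t \in `[0, 1] -> A t -> g (k t) < path_max g k.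
  move=> t01 At; rewrite kA// /g penalty_eq0 ?addr0; last exact: At.2.
  apply: lt_le_trans (S_lb k _) => //; have := cgamma t t01; lra.
have [|t [t01 gt nd]] := minimal_path_no_descent cg e0 ck cA Amax.
  by move=> k' ck' k'A; apply: kmin; split=> // t At; rewrite k'A ?kA.
have cmax : path_max g c <= gamma + eps ^+ 2 / 4 + eps ^+ 2.
  have [[s s01 <-] _] := path_max_attained cg cc.
  by apply: lerD; [exact: ltW (cgamma s s01)|exact: penalty_le].
have kmax := S_lb k (conj ck kA).
have ct : rel_dist M (c t) < eps.
  rewrite ltNge; apply/negP => ect; have := Amax t t01 (conj t01 ect).
  by rewrite gt ltxx.
(* The maxima along [c] and [k] differ by at most eps^2 / 4, so the exponent in [path_le] is at most
   eps / 4. *)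
have kct : `|k t - c t| <= (1 + `|c t|) * (eps / 2).
  apply: le_trans (kc t) _; rewrite ler_wpM2l ?addr_ge0//.
  have : expR ((path_max g c - path_max g k) / eps) <= expR (eps / 4).
    by rewrite ler_expR ler_pdivrMr//; move: cmax; rewrite !expr2; lra.
  have : expR (eps / 4) <= 1 + 2 * (eps / 4) by apply: expR_le_1D2x; lra.
  lra.
have k0 : 0 < 1 + `|k t| by rewrite ltr_pwDl.
have c0' : 0 < 1 + `|c t| by rewrite ltr_pwDl.
exists (k t); split.
(* The distance is at most (eps + eps / 2)(1 + |c t|), and 1 + |c t| <= 2 (1 + |k t|). *)
- rewrite ler_pdivrMr//; apply: le_trans (dist_leD M0 _ (c t)) _.
  rewrite -(rel_distK M (c t)).
  have := ler_wpM2r (ltW c0') (ltW ct).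
  have nck : `|c t| <= `|k t - c t| + `|k t|.
    by rewrite distrC -{1}[c t](subrK (k t)) ler_normD.
  have : (1 + `|c t|) * (eps / 2) <= (1 + `|c t|) * (1 / 2).
    by apply: ler_wpM2l; [exact: ltW|lra].
  move=> h1 h2; have h3 : 1 + `|c t| <= 2 * (1 + `|k t|) by lra.
  have := ler_wpM2l (ltW e0) h3; lra.
- by have := penalty_le M0 (k t) e0; move: gt kmax; rewrite /g; lra.
- have := penalty_ge0 M (k t) e0; have := path_le_mono e0 kc.
  by move: gt cmax; rewrite /g; lra.
split=> [|v a va]; first by rewrite !mulr_ge0 ?invr_ge0 ?ltW.
rewrite leNgt; apply/negP => alt; apply: nd.
have v0 : v != 0.
  apply/eqP => v0; move: va alt; rewrite v0 => /dir_bound0_ge0.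
  rewrite normr0 mulr0 oppr0; lra.
have nv : 0 < `|v| by rewrite normr_gt0.
(* Rescaled to length 1 + |k t|, the direction lowers Phi at rate 6 eps, while the penalty grows at
   rate at most 4 eps. The net rate 2 eps contradicts [nd]. *)
pose l := (1 + `|k t|) / `|v|; have l0 : 0 < l by rewrite divr_gt0.
have [rho rho0 hrho] := dir_boundZ l0 va.
have la : l * a < - (6 * eps).
  have -> : - (6 * eps) = l * - (6 * eps / (1 + `|k t|) * `|v|).
    by rewrite /l; field; rewrite !gt_eqF.
  by rewrite ltr_pM2l.
have nlv : `|l *: v| = 1 + `|k t|.
  by rewrite normrZ gtr0_norm// divfK// gt_eqF.
(* Radius at most 1 gives 1 + |k t| <= 2 (1 + |w|). *)
exists (l *: v), (Num.min rho 1); first by rewrite lt_min rho0 ltr01.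
move=> w; rewrite lt_min => /andP[wrho w1].
have lvw : `|l *: v| <= 2 * (1 + `|w|).
  rewrite nlv; have := ler_normD (k t - w) w; rewrite subrK distrC.
  have := normr_ge0 w; lra.
split=> // h h0; rewrite lt_min => /andP[hr _].
have := hrho w h wrho h0 hr.
have := penalty_leD M0 e0 e1 (ltW h0) lvw.
have := ltr_pM2r h0 (l * a) (- (6 * eps)); rewrite la.
rewrite /g; lra.
Qed.

End AlmostCritical.

(** * Assembling the sequence *)

Lemma cvg_harmonic_bound {R : realType} (a : nat -> R) (l C : R) : 0 < C ->
  (forall n, `|a n - l| <= C * n.+1%:R^-1) -> a n @[n --> \oo] --> l.
Proof.
move=> C0 h; apply/cvgrPdist_lt => e e0.
have [N _ hN] := near_infty_natSinv_lt (PosNum (divr_gt0 e0 C0)).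
exists N => // n /hN /= hn; rewrite distrC; apply: le_lt_trans (h n) _.
by rewrite mulrC -ltr_pdivlMr.
Qed.

Unset Implicit Arguments.

Theorem theorem1p9 (R : realType) (X : completeNormedModType R)
    (Phi : X -> R) (hPhi : locally_lipschitz Phi) (z0 z1 : X)
    (F : set X) (hF : closed F)
    (hsep : separates
       (F `&` [set x | minimax_level Phi z0 z1 <= Phi x]) z0 z1) :
  exists (x : nat -> X) (m : nat -> R),
    [/\ geodesic_dist_set (x n) F @[n --> \oo] --> (0 : R),
        Phi (x n) @[n --> \oo] --> minimax_level Phi z0 z1,
        (forall n, is_min [set dual_norm f | f in clarke_gradient Phi (x n)]
                          (m n))
      & (1 + `|x n|) * m n @[n --> \oo] --> (0 : R)].
Proof.
set gamma := minimax_level Phi z0 z1; set M := F `&` _ in hsep.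
have cPhi := locally_lipschitz_continuous hPhi.
have cross (k : R -> X) : continuous k -> k 0 = z0 -> k 1 = z1 ->
    exists2 t, t \in `[0 : R, 1] & M (k t).
  exact: separates_crossing hsep.
have M0 : M !=set0.
  have [t _ Mt] := cross _ (@segment_path_continuous _ _ z0 z1)
    (segment_path0 _ _) (segment_path1 _ _).
  by exists (segment_path z0 z1 t).
have Mgamma x : M x -> gamma <= Phi x by case.
have [cM [U0 [U1 [MO _ _ _ [Oz0 Oz1]]]]] := hsep.
have rel0 z : ~ M z -> 0 < rel_dist M z.
  by move=> nz; rewrite divr_gt0 ?dist_gt0// ltr_pwDl.
have rz0 : 0 < rel_dist M z0.
  by apply: rel0; rewrite -[~ M z0]/((~` M) z0) MO; left.
have rz1 : 0 < rel_dist M z1.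
  by apply: rel0; rewrite -[~ M z1]/((~` M) z1) MO; right.
(* The bound 1/8 ensures 4 eps <= 1/2 below; the other two make z0 and z1 lie at relative distance
   at least eps from [M]. *)
pose e0 := Num.min (1 / 8) (Num.min (rel_dist M z0) (rel_dist M z1)).
have e00 : 0 < e0 by rewrite !lt_min divr_gt0// rz0 rz1.
have [e08 e0z0 e0z1] :
    [/\ e0 <= 1 / 8, e0 <= rel_dist M z0 & e0 <= rel_dist M z1].
  by rewrite /e0 !ge_min !lexx !orbT.
(* The factor 8 covers all three estimates, whose constants are 8, 2 and 6 in terms of eps <=
   1/(n+1). *)
have /choice[p hp] n : exists p : X * R,
    [/\ geodesic_dist_set p.1 F <= 8 * n.+1%:R^-1,
        `|Phi p.1 - gamma| <= 8 * n.+1%:R^-1,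
        is_min [set dual_norm f | f in clarke_gradient Phi p.1] p.2 &
        0 <= (1 + `|p.1|) * p.2 <= 8 * n.+1%:R^-1].
  pose d : R := n.+1%:R^-1.
  have d0 : 0 < d by rewrite invr_gt0.
  have d1 : d <= 1 by rewrite invf_le1// ler1n.
  pose eps := e0 * d; have eps0 : 0 < eps by rewrite mulr_gt0.
  have epse : eps <= e0 by rewrite -[leRHS]mulr1 ler_wpM2l// ltW.
  have epsd : eps <= d by rewrite -[leRHS]mul1r ler_pM2r//; lra.
  have eps2 : eps ^+ 2 <= eps.
    by rewrite expr2 -[leRHS]mulr1 ler_pM2l//; lra.
  have ee4 : 0 < eps ^+ 2 / 4 by rewrite divr_gt0// exprn_gt0.
  have [c [cc c0 c1 cgamma]] := near_optimal_path z0 z1 cPhi ee4.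
  have [|||x [xM xg1 xg2 xs]] := almost_critical_point hPhi M0 Mgamma cross
    eps0 _ _ _ cc c0 c1 cgamma; [lra|lra|lra|].
  have [m [mmin m0 mle]] := exists_min_clarke_gradient x hPhi.
  have x0 : 0 < 1 + `|x| by rewrite ltr_pwDl.
  exists (x, m); rewrite -/d; split=> //=.
  - have : dist M x < 4 * eps * (1 + `|x|).
      rewrite -rel_distK ltr_pM2r//; lra.
    (* Since |x - y| is below half of 1 + |x|, the denominator in the segment estimate is at least
       the other half, which doubles 4 to 8. *)
    move=> /(dist_lt M0)[y [Fy _] xy].
    have xy2 : 4 * eps * (1 + `|x|) <= 1 / 2 * (1 + `|x|).
      by rewrite ler_pM2r//; lra.
    have xy1 : `|x - y| < 1 + `|x| by lra.
    apply: le_trans (geodesic_dist_set_le Fy xy1) _.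
    rewrite ler_pdivrMr ?subr_gt0//.
    have : 4 * d * (1 + `|x|) <= 8 * d * (1 + `|x| - `|x - y|).
      have : 0 <= d * ((1 + `|x|) / 2 - `|x - y|).
        by rewrite pmulr_rge0//; lra.
      lra.
    apply: le_trans; apply: le_trans (ltW xy) _.
    by rewrite ler_pM2r//; lra.
  - by rewrite ler_norml; lra.
  - rewrite (mulr_ge0 (ltW x0) m0) /=; have := mle _ xs.
    rewrite ler_pdivlMr// mulrC; lra.
exists (fun n => (p n).1), (fun n => (p n).2); split.
- apply: (@cvg_harmonic_bound _ _ _ 8) => // n; have [h _ _ _] := hp n.
  by rewrite subr0 ger0_norm// geodesic_dist_set_ge0.
- by apply: (@cvg_harmonic_bound _ _ _ 8) => // n; have [_ h _ _] := hp n.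
- by move=> n; have [_ _ h _] := hp n.
- apply: (@cvg_harmonic_bound _ _ _ 8) => // n.
  by have [_ _ _ /andP[h0 h]] := hp n; rewrite subr0 ger0_norm.
Qed.
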